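(* Let $M\subset\mathbb{R}^3$ be a smooth closed surface of genus zero with the metric induced from the Euclidean metric of $\mathbb{R}^3$, let $f:M\to\mathbb{S}^2$ be a conformal map to the round unit sphere, and let $h$ be its conformal factor, regarded as a positive function on $\mathbb{S}^2$ via $f^{-1}$. Let $q_1,\dots,q_n\in M$ ($n\in\mathbb{N}$) be distinct point vortices with strengths $\omega_1,\dots,\omega_n\in\mathbb{R}$ satisfying $\sum_{i=1}^n\omega_i=0$, and let $p_i:=f(q_i)\in\mathbb{S}^2$. Then for every $j$ the velocity $\vec u(p_j)$ on $\mathbb{S}^2$ of the point vortex at $p_j$ is $$\vec u(p_j)=\frac{1}{4\pi h(p_j)^2}\left(\sum_{\substack{i=1\\ i\neq j}}^n \omega_i\,\frac{p_j\times p_i}{1-p_j\cdot p_i}\;+\;\frac{1}{h(p_j)}\,\omega_j\,p_j\times\nabla_{p_j}h(p_j)\right).$$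
   Context: Conformal factor: if $\tilde g$ is the metric on $M$ and $g$ the round metric on $\mathbb{S}^2$, then $h>0$ is the function with $\tilde g_q(X,Y)=h(q)^2\,g_{f(q)}(d_fX,d_fY)$ for all $q\in M$, $X,Y\in T_qM$. A conformal map $M\to\mathbb{S}^2$ is smooth, angle preserving and (here) bijective; for $p\in\mathbb{S}^2$ we write $h(p)$ for $h(f^{-1}(p))$. Thus $M$ is identified with $\mathbb{S}^2$ carrying the metric $h^2g$. Symplectic gradients: for a function $F$ on $\mathbb{S}^2$ (round metric), $\operatorname{sgrad}_pF:=p\times\nabla_pF$, where $\nabla$ is the gradient on the round sphere and $p$ is the outer unit normal at $p$. With respect to the metric $h^2g$ the symplectic gradient is $\operatorname{sgrad}^*_pF:=\frac{1}{h(p)^2}\operatorname{sgrad}_pF$. Hamiltonian: let $G(x,y)=-\frac{1}{2\pi}\ln\!\left(\sin\!\left(\tfrac12\arccos(x\cdot y)\right)\right)$ for $x\ne y$ in $\mathbb{S}^2$. The spherical Hamiltonian is $H(p_1,\dots,p_n)=-\sum_{i<j}\omega_i\omega_jG(p_i,p_j)$. When the total vorticity $\sum_i\omega_i$ vanishes, the Hamiltonian of the point vortex system for the metric $h^2g$ is (theorem of Boatto and Koiller, taken as given) $$\tilde H(p_1,\dots,p_n)=H(p_1,\dots,p_n)-\frac{1}{4\pi}\sum_{i=1}^n\omega_i^2\log h(p_i).$$ Velocity: the velocity of the $j$-th point vortex (as a tangent vector of $\mathbb{S}^2$ at $p_j$) is $\vec u(p_j):=-\frac{1}{\omega_j}\operatorname{sgrad}^*_{p_j}\tilde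 H$, where the symplectic gradient is taken in the variable $p_j$. This gradient is polynomial in the strengths and divisible by $\omega_j$; for $\omega_j=0$ the expression is understood after cancelling the factor $\omega_j$. *)

(* Defs.v *)
From HB Require Import structures.
From mathcomp Require Export all_boot all_order all_algebra.
From mathcomp Require Export all_classical all_reals all_analysis.

Set Implicit Arguments.
Unset Strict Implicit.
Unset Printing Implicit Defensive.

Export Order.TTheory GRing.Theory Num.Theory.
Export numFieldNormedType.Exports.

#[global] Open Scope classical_set_scope.
#[global] Open Scope ring_scope.

Section Euclidean.
Context {R : realType}.
Implicit Types u v : 'rV[R]_3.

Definition dot u v : R := \sum_i u 0 i * v 0 i.

(* The library norm on 'rV[R]_3 is the sup norm. *)
Definition enorm u : R := Num.sqrt (dot u u).

Definition angle u v : R := acos (dot u v / (enorm u * enorm v)).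

(* Indices are added in 'I_3, i.e., modulo 3. *)
Definition cross u v : 'rV[R]_3 :=
  \row_i (u 0 (i + 1) * v 0 (i + 2%:R) - u 0 (i + 2%:R) * v 0 (i + 1)).

Definition sphere : set 'rV[R]_3 := [set x | enorm x = 1].

End Euclidean.

Section Smoothness.
Context {R : realType} {m n : nat}.
Implicit Types (W A : set 'rV[R]_m.+1) (f : 'rV[R]_m.+1 -> 'rV[R]_n.+1).

(* Used for open W only. *)
Fixpoint class_C (k : nat) W f : Prop :=
  if k is k'.+1 then
    forall v, (forall x, W x -> derivable f x v) /\
              class_C k' W (fun x => 'D_v f x)
  else forall x, W x -> {for x, continuous f}.

(* Smoothness on an arbitrary subset A: f locally agrees on A with a C^oo map
   defined on an open set of the ambient space. *)
Definition smooth_on A f : Prop :=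
  forall x, A x -> exists (W : set 'rV[R]_m.+1) (g : 'rV[R]_m.+1 -> 'rV[R]_n.+1),
    [/\ open W, W x, forall k, class_C k W g & {in W `&` A, f =1 g}].

End Smoothness.

Section Surfaces.
Context {R : realType}.
Implicit Types (A B M : set 'rV[R]_3) (f : 'rV[R]_3 -> 'rV[R]_3).

(* Embedded two-dimensional submanifold of R^3: every point of M has a
   neighbourhood in M diffeomorphic to an open subset of R^2. *)
Definition smooth_surface M : Prop :=
  forall q, M q ->
    exists (W : set 'rV[R]_3) (U : set 'rV[R]_2)
           (phi : 'rV[R]_2 -> 'rV[R]_3) (psi : 'rV[R]_3 -> 'rV[R]_2),
    [/\ [/\ open W, W q & open U],
        smooth_on U phi /\ smooth_on (M `&` W) psi,
        set_fun U (M `&` W) phi /\ set_fun (M `&` W) U psi,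
        {in U, cancel phi psi} &
        {in M `&` W, cancel psi phi}].

Definition closed_surface M : Prop :=
  [/\ smooth_surface M, compact M & connected M].

Definition homeomorphic A B : Prop :=
  exists (F G : 'rV[R]_3 -> 'rV[R]_3),
    [/\ {within A, continuous F} /\ {within B, continuous G},
        set_fun A B F /\ set_fun B A G,
        {in A, cancel F G} & {in B, cancel G F}].

(* A closed surface of genus g is a sphere with g handles attached. *)
Definition genus_zero M : Prop := homeomorphic M sphere.

(* c is a curve in A through q with velocity X there. Only differentiability
   at time 0 is asked; on a smooth submanifold this gives the same tangent
   vectors as smooth curves. *)
Definition curve_at A (q : 'rV[R]_3) (c : R -> 'rV[R]_3) (X : 'rV[R]_3) : Prop :=
  [/\ \forall t \near (0 : R), A (c t), c 0 = q & is_derive (0 : R) (1 : R) c X].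

Definition tangent A (q : 'rV[R]_3) : set 'rV[R]_3 :=
  [set X | exists c, curve_at A q c X].

(* The differential d_q f (X) of a map f on A. *)
Definition dmap A f (q X : 'rV[R]_3) : 'rV[R]_3 :=
  get [set Y | forall c, curve_at A q c X ->
                 is_derive (0 : R) (1 : R) (f \o c) Y].

Definition angle_preserving M f : Prop :=
  forall q X Y, M q -> tangent M q X -> tangent M q Y -> X != 0 -> Y != 0 ->
    [/\ dmap M f q X != 0, dmap M f q Y != 0 &
        angle (dmap M f q X) (dmap M f q Y) = angle X Y].

Definition conformal_map M f : Prop :=
  [/\ smooth_on M f, set_bij M sphere f & angle_preserving M f].

Definition conformal_factor M f (h : 'rV[R]_3 -> R) : Prop :=
  forall q, M q -> 0 < h q /\
    forall X Y, tangent M q X -> tangent M q Y ->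
      dot X Y = h q ^+ 2 * dot (dmap M f q X) (dmap M f q Y).

(* The gradient on the round sphere: the tangent vector representing the
   differential of F at p. *)
Definition sphere_grad (F : 'rV[R]_3 -> R) (p : 'rV[R]_3) : 'rV[R]_3 :=
  get [set v | tangent sphere p v /\
               forall c X, curve_at sphere p c X ->
                 is_derive (0 : R) (1 : R) (F \o c) (dot v X)].

Definition sgrad (F : 'rV[R]_3 -> R) (p : 'rV[R]_3) : 'rV[R]_3 :=
  cross p (sphere_grad F p).

Definition sgrad_star (h F : 'rV[R]_3 -> R) (p : 'rV[R]_3) : 'rV[R]_3 :=
  (h p ^+ 2)^-1 *: sgrad F p.

End Surfaces.

Section PointVortices.
Context {R : realType}.

Definition green (x y : 'rV[R]_3) : R :=
  - (2 * pi)^-1 * ln (sin (acos (dot x y) / 2)).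

Definition update {n : nat} {T : Type} (a : 'I_n -> T) (j : 'I_n) (x : T) :
  'I_n -> T := fun i => if i == j then x else a i.

Definition hamiltonian {n : nat} (w : 'I_n -> R) (p : 'I_n -> 'rV[R]_3) : R :=
  - \sum_(i < n) \sum_(j < n | (i < j)%N) w i * w j * green (p i) (p j).

Definition hamiltonian_conf {n : nat} (h : 'rV[R]_3 -> R) (w : 'I_n -> R)
    (p : 'I_n -> 'rV[R]_3) : R :=
  hamiltonian w p - (4 * pi)^-1 * \sum_(i < n) w i ^+ 2 * ln (h (p i)).

Definition sgrad_ham {n : nat} (h : 'rV[R]_3 -> R) (w : 'I_n -> R)
    (p : 'I_n -> 'rV[R]_3) (j : 'I_n) : 'rV[R]_3 :=
  sgrad_star h (fun x => hamiltonian_conf h w (update p j x)) (p j).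

(* If F s = s Q(s) for all s with Q polynomial in s, this is Q(t). *)
Definition cancel_factor (F : R -> 'rV[R]_3) (t : R) : 'rV[R]_3 :=
  get [set u | exists Q : 'I_3 -> {poly R},
         (forall s, F s = s *: \row_i (Q i).[s]) /\ u = \row_i (Q i).[t]].

(* For w j = 0 the factor w j of the symplectic gradient, viewed as a
   polynomial in the j-th strength, is cancelled before evaluating at 0. *)
Definition velocity {n : nat} (h : 'rV[R]_3 -> R) (w : 'I_n -> R)
    (p : 'I_n -> 'rV[R]_3) (j : 'I_n) : 'rV[R]_3 :=
  if w j != 0 then - (w j)^-1 *: sgrad_ham h w p j
  else - cancel_factor (fun s => sgrad_ham h (update w j s) p j) 0.

End PointVortices.

(* Main.v *)
(* Along a curve on the sphere, G(c t, y) = -(1/4pi) ln((1 - c t . y)/2) has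
   derivative (1/4pi) (y . c') / (1 - c . y), so the velocity formula is a
   computation once the conformal factor h is known to be differentiable on the
   sphere. In a chart phi of M, h = |d phi e| / |d (f \o phi) e|, which is
   differentiable. No inverse function theorem is needed to pass to the sphere:
   the inverse of f is continuous because M is compact, and a continuous curve u
   with F \o u differentiable and dF injective is itself differentiable. *)
From HB Require Import structures.
Require Import Defs.
From mathcomp Require Import ring lra.

Set Implicit Arguments.
Unset Strict Implicit.
Unset Printing Implicit Defensive.

(** Gradients and differentials are picked by [get] from conditions on all curves differentiable at
    the single time 0. Nothing can be computed from them until a candidate is exhibited and shown to
    be unique, and composing with such curves takes Frechet differentiability. Since [class_C]
    speaks of directional derivatives, this has to be recovered from continuous partial derivatives.
    For a function F on the sphere it then suffices to find any ambient vector [a], tangent or not,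
    with (F o c)'(0) = a . X: the gradient is the tangential part of [a], and the cross product with
    p kills the rest. This is how p_i itself, and not its projection, enters the formula. The case
    of zero strength is settled by reading the symplectic gradient as s times an affine function of
    the j-th strength s. *)

(** * Differential calculus in normed spaces *)

Lemma eps_is_diff (R : numFieldType) (V W : normedModType R)
    (f : V -> W) (x : V) (L : {linear V -> W}) : continuous L ->
  (forall e : R, 0 < e ->
    \forall v \near (0 : V), `|f (v + x) - f x - L v| <= e * `|v|) ->
  is_diff x f L.
Proof.
move=> cL fL.
have fE : f \o shift x = cst (f x) + L +o_ (0 : V) id.
  apply/eqaddoP => _/posnumP[e]; near=> v.
  rewrite /= opprD addrA; near: v; exact: fL.
have dfE := diff_unique cL fE.
by split; [apply/diff_locallyP; rewrite dfE|rewrite dfE].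
Unshelve. all: by end_near. Qed.

Lemma differentiable_eps (R : numFieldType) (V W : normedModType R)
    (f : V -> W) (x : V) (e : R) : differentiable f x -> 0 < e ->
  \forall v \near (0 : V), `|f (v + x) - f x - 'd f x v| <= e * `|v|.
Proof.
move=> /diff_locally /eqaddoP fx e0.
by near=> v; rewrite -addrA -opprD; near: v; exact: fx.
Unshelve. all: by end_near. Qed.

Lemma is_derive_line (R : numFieldType) (V W : normedModType R)
    (f : V -> W) (x v : V) (s : R) : derivable f (s *: v + x) v ->
  is_derive s 1 (fun t : R => f (t *: v + x)) ('D_v f (s *: v + x)).
Proof.
have E : (fun h : R => h^-1 *: (((fun t : R => f (t *: v + x)) \o shift s) (h *: 1)
              - f (s *: v + x)))
       = (fun h : R => h^-1 *: ((f \o shift (s *: v + x)) (h *: v)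
              - f (s *: v + x))).
  apply/funext => h /=; rewrite addrA -scalerDl; congr (_ *: (f _ - _)).
  by congr (_ *: _ + _); rewrite [_%:A]mulr1.
by move=> df; split; rewrite /derivable /derive E.
Qed.

Lemma differentiable_mx (R : realFieldType) (V : normedModType R) m n
    (f : V -> 'M[R]_(m, n)) (x : V) :
  (forall i j, differentiable (fun y => f y i j) x) -> differentiable f x.
Proof.
move=> df.
have -> : f = \sum_i \sum_j (fun y => f y i j *: delta_mx i j).
  apply/funext => y; rewrite fct_sumE [LHS]matrix_sum_delta.
  by apply: eq_bigr => i _; rewrite fct_sumE.
apply: differentiable_sum => i; apply: differentiable_sum => j.
exact: differentiableZl.
Qed.

Lemma continuous_mulmxr (R : realFieldType) m n p (A : 'M[R]_(n, p)) :
  continuous (mulmxr A : 'M[R]_(m, n) -> 'M[R]_(m, p)).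
Proof.
move=> x; apply: differentiable_continuous.
apply: differentiable_mx => i j.
have -> : (fun y : 'M[R]_(m, n) => mulmxr A y i j) =
    \sum_k (fun y : 'M[R]_(m, n) => A k j *: (y i k : R)).
  apply/funext => y; rewrite mxE fct_sumE.
  by apply: eq_bigr => k _; rewrite mulrC.
apply: differentiable_sum => k.
exact/differentiableZ/differentiable_coord.
Qed.

Lemma normr_entry_le (R : realFieldType) m n (A : 'M[R]_(m, n)) i j :
  `|A i j| <= `|A|.
Proof.
by rewrite [leRHS]/Num.Def.normr/= mx_normrE; exact: (le_bigmax _ _ (i, j)).
Qed.

Lemma normr_mx_le (R : realFieldType) m n (A : 'M[R]_(m, n)) (e : R) :
  0 <= e -> (forall i j, `|A i j| <= e) -> `|A| <= e.
Proof.
move=> e0 Ae.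
by rewrite [leLHS]/Num.Def.normr/= mx_normrE; apply: bigmax_le => // -[i j] _.
Qed.

(** Move from [x] to [v + x] one coordinate at a time. The mean value theorem turns each step into a
    partial derivative at a point near [x], and continuity at [x] replaces it by the partial
    derivative at [x] itself. *)
Lemma continuous_partials_differentiable (R : realType) m
    (W : set 'rV[R]_m) (f : 'rV[R]_m -> R) (x : 'rV[R]_m) :
  open W -> W x ->
  (forall i y, W y -> derivable f y (delta_mx 0 i)) ->
  (forall i, {for x, continuous (fun y => 'D_(delta_mx 0 i) f y)}) ->
  differentiable f x.
Proof.
move=> oW Wx df cf.
pose A : 'M[R]_(m, 1) := \col_i 'D_(delta_mx 0 i) f x.
pose Lf (v : 'rV[R]_m) : R := (mulmxr A v) 0 0.
have LfE v : Lf v = \sum_i v 0 i * 'D_(delta_mx 0 i) f x.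
  by rewrite /Lf /= mxE; apply: eq_bigr => i _; rewrite mxE.
have Lf_lin : linear Lf by move=> a u v; rewrite /Lf linearP !mxE.
pose LfM := GRing.isLinear.Build _ _ _ _ _ Lf_lin.
pose L : {linear 'rV[R]_m -> R} := HB.pack Lf LfM.
have cL : continuous L.
  move=> v; apply: (@continuous_comp _ _ _ (mulmxr A) (fun N => N 0 0)).
    exact: continuous_mulmxr.
  exact: coord_continuous.
suff H : is_diff x f L by exact: ex_diff.
apply: eps_is_diff => // e e0.
(* There are [m] steps, each with error at most this fraction of [|v|]; [m.+1] instead of [m] keeps
   the denominator nonzero when [m = 0]. *)
have e'0 : 0 < e / m.+1%:R by rewrite divr_gt0.
have cf' i : \forall y \near x,
    `|'D_(delta_mx 0 i) f x - 'D_(delta_mx 0 i) f y| <= e / m.+1%:R.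
  exact: ((cvgrPdist_le _ _).1 (cf i) _ e'0).
have oWx : nbhs x W by exact: open_nbhs_nbhs.
have : nbhs x [set y | W y /\
    forall i, `|'D_(delta_mx 0 i) f x - 'D_(delta_mx 0 i) f y| <= e / m.+1%:R].
  by apply: filterI => //; exact: (@filter_forall _ _ _ _ (nbhs_filter x) cf').
move=> /nbhs_ballP[d /= d0 xd].
apply/nbhs_ballP; exists d => //= v; rewrite -ball_normE /= sub0r normrN => vd.
pose part k : 'rV[R]_m := \row_i (if (i < k)%N then v 0 i else 0).
have part0 : part 0%N = 0 by apply/rowP => i; rewrite !mxE.
have partm : part m = v by apply/rowP => i; rewrite !mxE ltn_ord.
have partS (i : 'I_m) : part i.+1 = v 0 i *: delta_mx 0 i + part i.
  apply/rowP => k; rewrite !mxE eqxx /= ltnS leq_eqVlt.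
  have [->|ki] := eqVneq k i; first by rewrite eqxx ltnn mulr1 addr0.
  by rewrite (negPf (_ : (k != i :> nat))) // mulr0 add0r.
have tel : f (v + x) - f x = \sum_(i < m) (f (part i.+1 + x) - f (part i + x)).
  rewrite -(big_mkord xpredT (fun i => f (part i.+1 + x) - f (part i + x))).
  by rewrite telescope_sumr // part0 partm add0r.
rewrite tel /= LfE -sumrB.
apply: (le_trans (ler_norm_sum _ _ _)).
apply: (@le_trans _ _ (\sum_(i < m) e / m.+1%:R * `|v|)); last first.
  rewrite sumr_const card_ord -mulrnAl ler_wpM2r//.
  rewrite -mulr_natr -mulrA ler_piMr ?(ltW e0)// mulrC ler_pdivrMr// mul1r.
  by rewrite ler_nat.
apply: ler_sum => i _; rewrite partS -(addrA _ (part i)).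
set y := part i + x.
pose G (t : R) := f (t *: delta_mx 0 i + y).
(* In the sup norm every point of the broken path stays within [|v|] of [x], because its
   displacement is bounded by [v] entry by entry. *)
have near_y (t : R) : t \in `[0, 1]%R -> ball x d ((v 0 i * t) *: delta_mx 0 i + y).
  move=> /itvP t01; rewrite -ball_normE /= distrC addrA addrK.
  apply: le_lt_trans vd; apply: normr_mx_le => // a b; rewrite ord1 !mxE eqxx/=.
  have [->|_] := eqVneq b i.
    rewrite ltnn mulr1 addr0 normrM (le_trans _ (normr_entry_le v 0 i))//.
    by rewrite ler_piMr// ger0_norm t01.
  rewrite mulr0 add0r; case: ifP => _; last by rewrite normr0.
  exact: normr_entry_le.
have dG (t : R) : t \in `[0, 1]%R ->
    is_derive t 1 (G \o *%R (v 0 i))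
      ('D_(delta_mx 0 i) f ((v 0 i * t) *: delta_mx 0 i + y) * v 0 i).
  move=> t01; apply: is_derive1_comp.
    by apply: is_derive_line; apply: df; exact: (xd _ (near_y _ t01)).1.
  have := @is_deriveZ _ _ _ id (v 0 i) t 1 1 (is_derive_id _ _).
  by move/is_derive_eq; apply; rewrite [_ *: _]mulr1.
have dG' (t : R) : t \in `]0, 1[%R ->
    is_derive t 1 (G \o *%R (v 0 i))
      ('D_(delta_mx 0 i) f ((v 0 i * t) *: delta_mx 0 i + y) * v 0 i).
  by move=> t01; apply: dG; apply: subset_itv_oo_cc t01.
have cG : {within `[0, 1], continuous (G \o *%R (v 0 i))}.
  apply: derivable_within_continuous => t t01.
  exact: (@ex_derive _ _ _ _ _ _ _ (dG t t01)).
have [c c01] := MVT_segment ler01 dG' cG.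
rewrite /= mulr0 mulr1 /G scale0r add0r subr0 mulr1 => ->.
rewrite mulrC -mulrBr normrM mulrC ler_pM//; last exact: normr_entry_le.
by rewrite distrC; apply: (xd _ (near_y _ c01)).2.
Unshelve. all: by end_near. Qed.

Lemma class_C1_differentiable (R : realType) m n (W : set 'rV[R]_m.+1)
    (f : 'rV[R]_m.+1 -> 'rV[R]_n.+1) (x : 'rV[R]_m.+1) :
  open W -> class_C 1 W f -> W x -> differentiable f x.
Proof.
move=> oW Cf Wx; apply: differentiable_mx => i j.
apply: (continuous_partials_differentiable oW Wx) => [k y Wy|k].
  exact: (derivable_mxP _ _ _).1 ((Cf _).1 _ Wy) i j.
have [dfk cfk] := Cf (delta_mx 0 k).
(* Taking entries commutes with differentiation only where [f] is derivable, so the two functions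
   agree near [x] rather than everywhere. *)
have E : {near x, (fun y => 'D_(delta_mx 0 k) f y i j) =1
    (fun y => 'D_(delta_mx 0 k) (fun z => f z i j) y)}.
  near=> y; rewrite derive_mx ?mxE//; apply: dfk.
  by near: y; exact: open_nbhs_nbhs.
rewrite /prop_for /continuous_at -(nbhs_singleton E).
apply: cvg_trans; first exact: (near_eq_cvg E).
apply: (@continuous_comp _ _ _ (fun y => 'D_(delta_mx 0 k) f y) (fun N => N i j)).
  exact: cfk.
exact: coord_continuous.
Unshelve. all: by end_near. Qed.

Lemma class_C2_derive_differentiable (R : realType) m n (W : set 'rV[R]_m.+1)
    (f : 'rV[R]_m.+1 -> 'rV[R]_n.+1) (x v : 'rV[R]_m.+1) :
  open W -> class_C 2 W f -> W x -> differentiable (fun y => 'D_v f y) x.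
Proof. by move=> oW Cf; apply: class_C1_differentiable => //; have [] := Cf v. Qed.

Lemma is_derive_diff_comp (R : numFieldType) (V W : normedModType R)
    (f : V -> W) (c : R -> V) (t : R) (X : V) :
  differentiable f (c t) -> is_derive t 1 c X ->
  is_derive t 1 (f \o c) ('d f (c t) X).
Proof.
move=> df [/derivable1_diffP dc <-].
have dfc : differentiable (f \o c) t by exact: differentiable_comp.
split; first exact/derivable1_diffP.
by rewrite !deriveE// diff_comp.
Qed.

(* A curve u is differentiable as soon as G \o u is, when dG = id: the error
   G (u t) - G (u 0) - (u t - u 0) is o(u t - u 0), which first bounds u t - u 0
   by O(t) and is then itself o(t). *)
Lemma is_derive_of_comp (R : realType) (V : normedModType R)
    (G : V -> V) (u : R -> V) (Y : V) :
  differentiable G (u 0) -> (forall v, 'd G (u 0) v = v) ->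
  {for 0, continuous u} -> is_derive (0 : R) 1 (G \o u) Y ->
  is_derive (0 : R) 1 u Y.
Proof.
move=> dG dGid cu [/derivable1_diffP dGu dGuY].
have L_lin : linear (fun t : R => t *: Y).
  by move=> a s t; rewrite scalerDl scalerA.
pose LM := GRing.isLinear.Build _ _ _ _ _ L_lin.
pose L : {linear R -> V} := HB.pack (fun t : R => t *: Y) LM.
have dGuE t : 'd (G \o u) 0 t = t *: Y.
  by rewrite -dGuY deriveE// -linearZ/= [_ *: _]mulr1.
suff H : is_diff 0 u L.
  have du : differentiable u 0 by exact: ex_diff.
  split; first exact/derivable1_diffP.
  by rewrite deriveE// diff_val /= scale1r.
apply: eps_is_diff; first exact: scalel_continuous.
move=> e e0; pose k := `|Y| + 1.
have k0 : 0 < k by rewrite ltr_wpDl.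
(* With [a <= 1] the increment of G o u is at most [k * |t|]; with [b <= 1/2] the error is absorbed
   and [|u t - u 0| <= 2 * k * |t|]. The other two bounds then make each of the two remaining errors
   at most [e / 2 * |t|]. *)
pose a := Num.min 1 (e / 2); pose b := Num.min (2^-1) (e / (4 * k)).
have a0 : 0 < a by rewrite lt_min ltr01 divr_gt0.
have b0 : 0 < b by rewrite lt_min invr_gt0 ltr0n divr_gt0// mulr_gt0.
have Hb : \forall t \near (0 : R),
    `|G (u t) - G (u 0) - (u t - u 0)| <= b * `|u t - u 0|.
  have : (u t - u 0) @[t --> (0 : R)] --> (0 : V).
    by rewrite -(subrr (u 0)); apply: cvgB => //; exact: cvg_cst.
  move/(_ _ (differentiable_eps dG b0)) => H; near=> t.
  have : `|G (u t - u 0 + u 0) - G (u 0) - 'd G (u 0) (u t - u 0)| <=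
    b * `|u t - u 0| by near: t; exact: H.
  by rewrite dGid subrK.
have Ha := differentiable_eps dGu a0.
near=> t.
have : `|G (u t) - G (u 0) - (u t - u 0)| <= b * `|u t - u 0| by near: t.
have : `|(G \o u) (t + 0) - (G \o u) 0 - 'd (G \o u) 0 t| <= a * `|t|.
  by near: t.
rewrite /= addr0 dGuE.
set h := u t - u 0; set D := G (u t) - G (u 0) => HD Hh.
have Dk : `|D| <= k * `|t|.
  rewrite -[D](subrK (t *: Y)) (le_trans (ler_normD _ _))// normrZ.
  rewrite mulrDl mul1r (mulrC `|t|) addrC lerD2l (le_trans HD)//.
  by rewrite ler_piMl// ge_min lexx.
have hk : `|h| <= 2 * k * `|t|.
  have : `|h| <= `|D| + `|D - h|.
    by rewrite -{1}[h](subKr D) (le_trans (ler_normB _ _)).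
  have : b * `|h| <= 2^-1 * `|h| by rewrite ler_wpM2r// ge_min lexx.
  lra.
have bh : b * `|h| <= e / 2 * `|t|.
  apply: (@le_trans _ _ (e / (4 * k) * (2 * k * `|t|))).
    by rewrite ler_pM// ?(ltW b0)// ge_min lexx orbT.
  by rewrite le_eqVlt; apply/orP; left; apply/eqP; field; rewrite gt_eqF.
have aht : a * `|t| <= e / 2 * `|t| by rewrite ler_wpM2r// ge_min lexx orbT.
have -> : h - t *: Y = (D - t *: Y) - (D - h).
  by rewrite opprB [RHS]addrC addrA subrK.
apply: (le_trans (ler_normB _ _)); lra.
Unshelve. all: by end_near. Qed.

(** * Continuity on subsets and continuity of inverses *)

Lemma smooth_on_within_continuous (R : realType) m n
    (A : set 'rV[R]_m.+1) (f : 'rV[R]_m.+1 -> 'rV[R]_n.+1) :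
  smooth_on A f -> {within A, continuous f}.
Proof.
move=> sf; apply/subspace_continuousP => x Ax.
have [W [g [oW Wx Cg fg]]] := sf x Ax.
have fgx : f x = g x by apply: fg; rewrite inE.
have cg : g y @[y --> within A (nbhs x)] --> f x.
  by rewrite fgx; exact: cvg_within_filter (Cg 0%N x Wx).
apply: cvg_trans cg.
apply: near_eq_cvg; rewrite near_withinE; near=> y => Ay.
apply: esym; apply: fg; rewrite inE; split => //; near: y; exact: open_nbhs_nbhs.
Unshelve. all: by end_near. Qed.

(** On a compact set [f] is a closed map: for W' open, the image of [A] minus W' is compact, hence
    closed in a Hausdorff space, and off this image [g] takes its values in W'. *)
Lemma compact_continuous_inverse (T U : topologicalType) (A : set T) (B : set U)
    (f : T -> U) (g : U -> T) : hausdorff_space U -> compact A ->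
  {within A, continuous f} -> {in A &, injective f} ->
  set_fun B A g -> {in B, cancel g f} ->
  {within B, continuous g}.
Proof.
move=> hU cA cf finj pA gK; apply/subspace_continuousP => y By.
have pK z : B z -> f (g z) = z by move=> Bz; apply: gK; rewrite inE.
move=> W; rewrite nbhsE => -[W' [oW' W'y] W'W].
have cK : compact (f @` (A `&` ~` W')).
  apply: continuous_compact.
    by apply: continuous_subspaceW cf; exact: subIsetl.
  by apply: compact_closedI => //; exact: open_closedC.
have oK : open (~` (f @` (A `&` ~` W'))).
  by rewrite openC; exact: compact_closed.
have Ky : (~` (f @` (A `&` ~` W'))) y.
  move=> [z [Az W'z] fzy]; apply: W'z.
  by rewrite (_ : z = g y)//; apply: finj;
    rewrite ?inE ?pK//; exact: pA.
have : nbhs y (~` (f @` (A `&` ~` W'))) by exact: open_nbhs_nbhs.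
rewrite /fmap /within /= /nbhs /=; apply: filterS => z Kz Bz.
apply: W'W; apply: contrapT => nW; apply: Kz.
by exists (g z); rewrite ?pK//; split => //; exact: pA.
Qed.

(** * Dot and cross products in R^3 *)

Section dot_cross.
Context {R : realType}.
Implicit Types u v w : 'rV[R]_3.

Lemma dotC u v : dot u v = dot v u.
Proof. by apply: eq_bigr => i _; rewrite mulrC. Qed.

Lemma dotDr u v w : dot u (v + w) = dot u v + dot u w.
Proof. by rewrite -big_split; apply: eq_bigr => i _; rewrite mxE mulrDr. Qed.

Lemma dotZr (a : R) u v : dot u (a *: v) = a * dot u v.
Proof. by rewrite mulr_sumr; apply: eq_bigr => i _; rewrite mxE mulrCA. Qed.

Lemma dotDl u v w : dot (u + v) w = dot u w + dot v w.
Proof. by rewrite dotC dotDr !(dotC w). Qed.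

Lemma dotZl (a : R) u v : dot (a *: u) v = a * dot u v.
Proof. by rewrite dotC dotZr dotC. Qed.

Lemma dot_suml (I : Type) (r : seq I) (P : pred I) (F : I -> 'rV[R]_3) v :
  dot (\sum_(i <- r | P i) F i) v = \sum_(i <- r | P i) dot (F i) v.
Proof.
apply: (big_morph (dot^~ v)) => [u w|]; first exact: dotDl.
by rewrite -(scale0r 0) dotZl mul0r.
Qed.

Lemma dotNr u v : dot u (- v) = - dot u v.
Proof. by rewrite -scaleN1r dotZr mulN1r. Qed.

Lemma dotNl u v : dot (- u) v = - dot u v.
Proof. by rewrite dotC dotNr dotC. Qed.

Lemma dot_ge0 u : 0 <= dot u u.
Proof. by apply: sumr_ge0 => i _; rewrite -expr2 sqr_ge0. Qed.

Lemma dot_eq0 u : (dot u u == 0) = (u == 0).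
Proof.
apply/eqP/eqP => [/eqP|->]; last by rewrite -(scale0r 0) dotZl mul0r.
rewrite psumr_eq0 => [/allP u0|i _]; last by rewrite -expr2 sqr_ge0.
apply/rowP => i; apply/eqP; rewrite mxE -sqrf_eq0 expr2.
by apply: u0; rewrite mem_index_enum.
Qed.

Lemma crossDr u v w : cross u (v + w) = cross u v + cross u w.
Proof. by apply/rowP => i; rewrite !mxE; ring. Qed.

Lemma crossZr (a : R) u v : cross u (a *: v) = a *: cross u v.
Proof. by apply/rowP => i; rewrite !mxE; ring. Qed.

Lemma crossuu u : cross u u = 0.
Proof. by apply/rowP => i; rewrite !mxE; ring. Qed.

Lemma cross_sumr (I : Type) (r : seq I) (P : pred I) (F : I -> 'rV[R]_3) u :
  cross u (\sum_(i <- r | P i) F i) = \sum_(i <- r | P i) cross u (F i).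
Proof.
apply: (big_morph (cross u)) => [v w|]; first exact: crossDr.
by rewrite -(scale0r 0) crossZr !scale0r.
Qed.

Lemma sphereP u : sphere u <-> dot u u = 1.
Proof.
rewrite /sphere /= /enorm; split => [u1|->]; last exact: sqrtr1.
by rewrite -[LHS](sqr_sqrtr (dot_ge0 u)) u1 expr1n.
Qed.

Lemma sphere_dot_le1 u v : sphere u -> sphere v -> -1 <= dot u v <= 1.
Proof.
move=> /sphereP u1 /sphereP v1.
have := dot_ge0 (u + v); have := dot_ge0 (u - v).
rewrite !(dotDl, dotDr, dotNl, dotNr) (dotC v u) u1 v1.
by move=> ? ?; apply/andP; split; lra.
Qed.

(** On the sphere |u - v|^2 = 2 - 2 u . v, so the value 1 forces u = v. This keeps the denominators
    of the velocity formula positive. *)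
Lemma sphere_dot_lt1 u v : sphere u -> sphere v -> u != v -> dot u v < 1.
Proof.
move=> su sv uv; have /andP[_ d1] := sphere_dot_le1 su sv.
rewrite lt_neqAle d1 andbT; apply: contra uv => /eqP duv.
move: su sv => /sphereP u1 /sphereP v1.
rewrite -subr_eq0 -dot_eq0 !(dotDl, dotDr, dotNl, dotNr) (dotC v u) u1 v1 duv.
by apply/eqP; ring.
Qed.

Lemma is_derive_entry m n (f : R -> 'M[R]_(m, n)) (t : R) (X : 'M[R]_(m, n)) i j :
  is_derive t 1 f X -> is_derive t 1 (fun s => f s i j) (X i j).
Proof.
move=> [df <-]; split; first exact: (derivable_mxP _ _ _).1 df i j.
by rewrite derive_mx// mxE.
Qed.

Lemma is_derive_dot (a b : R -> 'rV[R]_3) (t : R) (A B : 'rV[R]_3) :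
  is_derive t 1 a A -> is_derive t 1 b B ->
  is_derive t 1 (fun s => dot (a s) (b s)) (dot A (b t) + dot (a t) B).
Proof.
move=> da db.
have -> : (fun s => dot (a s) (b s)) =
    \sum_i ((fun s => a s 0 i) * (fun s => b s 0 i)).
  by apply/funext => s; rewrite fct_sumE.
rewrite /dot -big_split /=; apply: is_derive_sum => i.
have := is_deriveM (is_derive_entry 0 i da) (is_derive_entry 0 i db).
by move/is_derive_eq; apply; rewrite /GRing.scale /=; ring.
Qed.

Lemma is_derive_dotl (a : 'rV[R]_3) (b : R -> 'rV[R]_3) (t : R) (B : 'rV[R]_3) :
  is_derive t 1 b B -> is_derive t 1 (fun s => dot a (b s)) (dot a B).
Proof.
move=> db; have := is_derive_dot (is_derive_cst a t 1) db.
move/is_derive_eq; apply.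
by rewrite (_ : dot 0 (b t) = 0) ?add0r// -(scale0r 0) dotZl mul0r.
Qed.

Lemma differentiable_dot (V : normedModType R) (a b : V -> 'rV[R]_3) (x : V) :
  differentiable a x -> differentiable b x ->
  differentiable (fun y => dot (a y) (b y)) x.
Proof.
move=> da db.
have -> : (fun y => dot (a y) (b y)) =
    \sum_i ((fun y => a y 0 i) * (fun y => b y 0 i)).
  by apply/funext => s; rewrite fct_sumE.
apply: differentiable_sum => i; apply: differentiableM.
  apply: (@differentiable_comp _ _ _ _ a (fun N : 'rV[R]_3 => N 0 i : R)) => //.
  exact: differentiable_coord.
apply: (@differentiable_comp _ _ _ _ b (fun N : 'rV[R]_3 => N 0 i : R)) => //.
exact: differentiable_coord.
Qed.

End dot_cross.

(** * Tangent vectors and gradients on the round sphere *)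

Section sphere_gradient.
Context {R : realType}.
Implicit Types (p X a : 'rV[R]_3) (F : 'rV[R]_3 -> R).

Lemma curve_at_sphere_orthogonal p c X : curve_at sphere p c X -> dot p X = 0.
Proof.
move=> [sc c0 dc].
have H := is_derive_dot dc dc.
have K : is_derive (0 : R) 1 (fun s => dot (c s) (c s)) 0.
  have := @near_eq_is_derive R R R (cst 1) (fun s => dot (c s) (c s)) 0 1 0.
  apply.
  by apply: filterS sc => t /sphereP ->.
move: (@derive_val _ _ _ _ _ _ _ H); rewrite (@derive_val _ _ _ _ _ _ _ K).
by rewrite c0 (dotC X); lra.
Qed.

Lemma orthogonal_tangent_sphere p X : sphere p -> dot p X = 0 ->
  tangent sphere p X.
Proof.
(* The value of [a] makes |(1 - t^2 a) p + t X|^2 = (1 - t^2 a)^2 + 4 a t^2 a perfect square, namely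
   (1 + t^2 a)^2. The curve is rational in t, and X = 0 needs no separate case. *)
move=> /sphereP p1 pX; pose a := dot X X / 4.
have a0 : 0 <= a by rewrite divr_ge0// dot_ge0.
pose r (t : R) := (1 + t ^+ 2 * a)^-1.
pose b (t : R) := 1 - t ^+ 2 * a.
have d0 (t : R) : 1 + t ^+ 2 * a != 0.
  by rewrite gt_eqF// ltr_pwDl// mulr_ge0// sqr_ge0.
(* Inverse stereographic projection restricted to a line. *)
exists (fun t => r t *: (b t *: p + t *: X)); split.
- apply: filterE => t; apply/sphereP.
  rewrite !(dotZl, dotZr, dotDl, dotDr) (dotC X p) pX p1.
  have -> : dot X X = 4 * a by rewrite /a; field.
  rewrite /r /b; field; exact: d0.
- by rewrite /r /b expr0n /= mul0r addr0 subr0 invr1 !scale1r scale0r addr0.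
have dq : is_derive (0 : R) 1 (fun t : R => 1 + t ^+ 2 * a) 0.
  have -> : (fun t : R => 1 + t ^+ 2 * a) = cst 1 + a *: (id ^+ 2 : R -> R).
    by apply/funext => t /=; rewrite mulrC.
  apply: is_derive_eq.
  by rewrite add0r /= expr1 mulr0 scale0r scaler0.
have dr : is_derive (0 : R) 1 r 0.
  have := @is_deriveV _ _ 0 0 1 (d0 0) dq.
  by move/is_derive_eq; apply; rewrite scaler0.
have db : is_derive (0 : R) 1 b 0.
  have -> : b = cst 1 - a *: (id ^+ 2 : R -> R).
    by apply/funext => t /=; rewrite /b mulrC.
  apply: is_derive_eq.
  by rewrite /= expr1 mulr0 scale0r scaler0 subrr.
have E i j : is_derive (0 : R) 1
    (fun t => (r t *: (b t *: p + t *: X)) i j) (X i j).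
  have -> : (fun t => (r t *: (b t *: p + t *: X)) i j) =
      r * (p i j *: b + X i j *: (id : R -> R)).
    by apply/funext => t; rewrite !mxE /= mulrC (mulrC (b t)) (mulrC t) mulrC.
  apply: is_derive_eq.
  rewrite /r expr0n /= mul0r addr0 invr1 !scaler0 add0r addr0 scale1r.
  by rewrite /GRing.scale /= mulr1.
have D : derivable (fun t => r t *: (b t *: p + t *: X)) (0 : R) 1.
  by apply/derivable_mxP => i j; exact: (@ex_derive _ _ _ _ _ _ _ (E i j)).
split => //; apply/matrixP => i j; rewrite derive_mx// mxE.
exact: (@derive_val _ _ _ _ _ _ _ (E i j)).
Qed.

Lemma sphere_gradE F p a : sphere p ->
  (forall c X, curve_at sphere p c X ->
     is_derive (0 : R) 1 (F \o c) (dot a X)) ->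
  sphere_grad F p = a - dot p a *: p.
Proof.
move=> sp Fa; have p1 := (sphereP p).1 sp.
set v := a - _.
have pv : dot p v = 0 by rewrite dotDr dotNr dotZr p1 mulr1 subrr.
have vX c X : curve_at sphere p c X -> dot a X = dot v X.
  by move=> /curve_at_sphere_orthogonal pX; rewrite dotDl dotNl dotZl pX mulr0 subr0.
have Fv : tangent sphere p v /\ forall c X, curve_at sphere p c X ->
    is_derive (0 : R) 1 (F \o c) (dot v X).
  split; first exact: orthogonal_tangent_sphere.
  by move=> c X cX; rewrite -(vX _ _ cX); exact: Fa.
have [[c' c'v] Fg] := getPex (ex_intro (fun u => [set v | tangent sphere p v /\
               forall c X, curve_at sphere p c X ->
                 is_derive (0 : R) (1 : R) (F \o c) (dot v X)] u) _ Fv).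
rewrite -/(sphere_grad F p) in c'v Fg *; set g := sphere_grad F p in c'v Fg *.
have pg := curve_at_sphere_orthogonal c'v.
(* Uniqueness: the difference of two gradients is itself a tangent direction, and testing both along
   it gives |g - v|^2 = 0. *)
have [c cX] : tangent sphere p (g - v).
  by apply: orthogonal_tangent_sphere => //; rewrite dotDr dotNr pg pv subrr.
apply/eqP; rewrite -subr_eq0 -dot_eq0 dotDl dotNl.
rewrite -(@derive_val _ _ _ _ _ _ _ (Fg _ _ cX)).
by rewrite (@derive_val _ _ _ _ _ _ _ (Fv.2 _ _ cX)) subrr.
Qed.

Lemma sgradE F p a : sphere p ->
  (forall c X, curve_at sphere p c X ->
     is_derive (0 : R) 1 (F \o c) (dot a X)) ->
  sgrad F p = cross p a.
Proof.
move=> sp Fa; rewrite /sgrad (sphere_gradE sp Fa) crossDr -scaleNr crossZr.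
by rewrite crossuu scaler0 addr0.
Qed.

End sphere_gradient.

(** * Charts and differentiability of the conformal factor *)

(** The chain rule shows that ['d g q X] satisfies the condition under [get]; a curve witnessing
    that X is tangent makes the solution unique. *)
Lemma dmapE (R : realType) (M W : set 'rV[R]_3) (f g : 'rV[R]_3 -> 'rV[R]_3)
    (q X : 'rV[R]_3) :
  open W -> W q -> {in W `&` M, f =1 g} -> differentiable g q ->
  tangent M q X -> dmap M f q X = 'd g q X.
Proof.
move=> oW Wq fg dg [c0 cX0].
have H c : curve_at M q c X -> is_derive (0 : R) 1 (f \o c) ('d g q X).
  move=> [Mc cq dc]; rewrite -cq in dg *.
  have := is_derive_diff_comp dg dc; apply: near_eq_is_derive.
  have cc : {for 0, continuous c}.
    by apply/differentiable_continuous/derivable1_diffP; exact: ex_derive.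
  have Wc : \forall t \near (0 : R), W (c t).
    by apply: cc; rewrite cq; exact: open_nbhs_nbhs.
  near=> t; apply: esym; apply: fg; rewrite inE; split; by near: t.
have Hg := getPex (ex_intro (fun Y => [set Y | forall c, curve_at M q c X ->
                 is_derive (0 : R) (1 : R) (f \o c) Y] Y) _ H).
rewrite -/(dmap M f q X) in Hg.
rewrite -(@derive_val _ _ _ _ _ _ _ (H _ cX0)).
by rewrite (@derive_val _ _ _ _ _ _ _ (Hg _ cX0)).
Unshelve. all: by end_near. Qed.

Lemma near_line (R : realType) (V : normedModType R) (Q : set V) (u e : V) :
  open Q -> Q u -> \forall t \near (0 : R), Q (t *: e + u).
Proof.
move=> oO Ou.
have c : (fun t : R => t *: e + u) @ (0 : R) --> (0 : R) *: e + u.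
  by apply: cvgD; [exact: scalel_continuous|exact: cvg_cst].
by apply: c; apply: open_nbhs_nbhs; rewrite scale0r add0r.
Qed.

Section chart.
Context {R : realType} (M W : set 'rV[R]_3) (U V : set 'rV[R]_2)
  (phi phi1 : 'rV[R]_2 -> 'rV[R]_3) (psi : 'rV[R]_3 -> 'rV[R]_2).
Hypotheses (oU : open U) (spsi : smooth_on (M `&` W) psi)
  (phiMW : set_fun U (M `&` W) phi) (phiK : {in U, cancel phi psi})
  (oV : open V) (phiE : {in V `&` U, phi =1 phi1}) (Cphi1 : class_C 1 V phi1).

Lemma curve_at_chart (u e : 'rV[R]_2) : U u -> V u ->
  curve_at M (phi u) (fun t : R => phi (t *: e + u)) ('d phi1 u e).
Proof.
move=> Uu Vu; split; last 1 first.
- have d1 := class_C1_differentiable oV Cphi1 Vu.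
  have : is_derive (0 : R) 1 (fun t : R => phi1 (t *: e + u)) ('d phi1 u e).
    have := @is_derive_line _ _ _ phi1 u e 0.
    rewrite scale0r add0r => /(_ (diff_derivable d1)).
    by rewrite deriveE.
  apply: near_eq_is_derive; near=> t; apply: esym; apply: phiE.
  by rewrite inE; split; near: t; exact: near_line.
- near=> t; suff /phiMW[] : U (t *: e + u) by [].
  by near: t; exact: near_line.
- by rewrite scale0r add0r.
Unshelve. all: by end_near. Qed.

(** The inverse chart extends to a smooth map Psi of an open set of R^3. Differentiating Psi o phi =
    id along the line through [u] recovers [e] as the image of ['d phi1 u e] under dPsi. *)
Lemma chart_immersion (u e : 'rV[R]_2) : U u -> V u ->
  'd phi1 u e = 0 -> e = 0.
Proof.
move=> Uu Vu de0.
have [Q [Psi [oO Ou CPsi psiE]]] := spsi (phiMW Uu).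
have dPsi := class_C1_differentiable oO (CPsi 1%N) Ou.
have [_ cu dc] := curve_at_chart e Uu Vu.
rewrite -cu in dPsi Ou.
have dPc := is_derive_diff_comp dPsi dc.
have cc : {for 0, continuous (fun t : R => phi (t *: e + u))}.
  by apply/differentiable_continuous/derivable1_diffP; exact: ex_derive.
have oOc : \forall t \near (0 : R), Q (phi (t *: e + u)).
  by apply: cc; exact: open_nbhs_nbhs.
have dl : is_derive (0 : R) 1 (fun t : R => t *: e + u) e.
  have := @is_derive_line _ _ _ (id : 'rV[R]_2 -> 'rV[R]_2) u e 0 (@derivable_id _ _ _ _).
  by rewrite derive_id.
have dl' : is_derive (0 : R) 1 (Psi \o (fun t : R => phi (t *: e + u))) e.
  apply: near_eq_is_derive dl; near=> t => /=.
  have Ut : U (t *: e + u) by near: t; exact: near_line.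
  rewrite -psiE ?phiK ?inE//; split; first by near: t.
  exact: phiMW.
rewrite -(@derive_val _ _ _ _ _ _ _ dl') (@derive_val _ _ _ _ _ _ _ dPc).
by rewrite de0 linear0.
Unshelve. all: by end_near. Qed.

End chart.

(* In a chart phi the conformal factor is |d phi e| / |d (f \o phi) e| for any
   nonzero vector e, whence its differentiability. *)
Lemma conformal_factor_chart (R : realType) (M : set 'rV[R]_3)
    (f : 'rV[R]_3 -> 'rV[R]_3) (hM : 'rV[R]_3 -> R) (q : 'rV[R]_3) :
  smooth_surface M -> smooth_on M f -> conformal_factor M f hM -> M q ->
  exists (psi : 'rV[R]_3 -> 'rV[R]_2) (F : 'rV[R]_2 -> 'rV[R]_3)
    (k : 'rV[R]_2 -> R),
  [/\ psi y @[y --> within M (nbhs q)] --> psi q,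
      \forall y \near within M (nbhs q), F (psi y) = f y /\ k (psi y) = hM y,
      differentiable F (psi q),
      (forall v, 'd F (psi q) v = 0 -> v = 0) &
      differentiable k (psi q)].
Proof.
move=> sM sf chf Mq.
have [W [U [phi [psi [[oW Wq oU] [sphi spsi] [phiMW psiU] phiK psiK]]]]] := sM q Mq.
set u0 := psi q.
have MWq : (M `&` W) q by [].
have Uu0 : U u0 by exact: psiU.
have phiu0 : phi u0 = q by apply: psiK; rewrite inE.
have [V [phi1 [oV Vu0 Cphi1 phiE]]] := sphi u0 Uu0.
have [Q [g [oO Oq Cg fg]]] := sf q Mq.
have dphi u : V u -> differentiable phi1 u.
  exact: class_C1_differentiable oV (Cphi1 1%N).
have dg y : Q y -> differentiable g y.
  exact: class_C1_differentiable oO (Cg 1%N).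
have phi1E u : U u -> V u -> phi u = phi1 u.
  by move=> Uu Vu; apply: phiE; rewrite inE.
have key u e : U u -> V u -> Q (phi u) ->
    dot ('d phi1 u e) ('d phi1 u e) =
      hM (phi u) ^+ 2 * dot ('d g (phi u) ('d phi1 u e)) ('d g (phi u) ('d phi1 u e)).
  move=> Uu Vu Ou.
  have tu : tangent M (phi u) ('d phi1 u e).
    eexists; exact: (curve_at_chart oU phiMW oV phiE (Cphi1 1%N)).
  have [Mu _] := phiMW _ Uu.
  rewrite -(dmapE oO Ou fg (dg _ Ou) tu).
  exact: (chf _ Mu).2.
(* Conformality makes the differential of [f] injective on tangent vectors: by [key], a vector with
   zero image has length zero. *)
have key0 u e : U u -> V u -> Q (phi u) -> 'd g (phi u) ('d phi1 u e) = 0 -> e = 0.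
  move=> Uu Vu Ou dg0.
  apply: (chart_immersion oU spsi phiMW phiK oV phiE (Cphi1 1%N) Uu Vu).
  apply/eqP; rewrite -dot_eq0 key// dg0 -[X in dot X _](scale0r 0) dotZl.
  by rewrite mul0r mulr0.
have cpsi : psi y @[y --> within M (nbhs q)] --> psi q.
  have := (@subspace_continuousP _ (M `&` W) _ psi).1
    (smooth_on_within_continuous spsi) q MWq.
  apply: cvg_trans; apply: cvg_app; rewrite /within /= => A.
  rewrite !nbhs_simpl /= => MA; near=> y => My.
  have Wy : W y by near: y; exact: open_nbhs_nbhs.
  by apply: (near MA y _).
pose e : 'rV[R]_2 := delta_mx 0 0.
have e0 : e != 0.
  by apply/eqP => /matrixP/(_ 0 0); rewrite !mxE eqxx => /eqP; rewrite oner_eq0.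
pose E u := 'D_e phi1 u.
(* The differential of f o phi on [e], expanded in fixed directions: [class_C] controls ['D_v g] for
   constant [v], whereas the direction [E u] moves with [u]. *)
pose D u := \sum_i E u 0 i *: 'D_(delta_mx 0 i) g (phi1 u).
have DE u : V u -> Q (phi1 u) -> D u = 'd g (phi1 u) ('d phi1 u e).
  move=> Vu Ou; rewrite -(deriveE _ (dphi _ Vu)) -/(E u).
  rewrite [in RHS](row_sum_delta (E u)) linear_sum; apply: eq_bigr => i _.
  by rewrite linearZ /= deriveE//; exact: dg.
pose k u := Num.sqrt (dot (E u) (E u) / dot (D u) (D u)).
have Dn0 u : U u -> V u -> Q (phi u) -> 0 < dot (D u) (D u).
  move=> Uu Vu Ou; rewrite lt_neqAle dot_ge0 andbT eq_sym dot_eq0.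
  apply/eqP; rewrite DE -?phi1E// => /key0.
  by move=> /(_ Uu Vu Ou)/eqP; rewrite (negPf e0).
exists psi, (g \o phi1), k; split => //.
- have oV' : \forall y \near within M (nbhs q), V (psi y).
    by apply: cpsi; exact: open_nbhs_nbhs.
  have oW' : \forall y \near within M (nbhs q), W y.
    by apply: cvg_within; exact: open_nbhs_nbhs.
  have oO' : \forall y \near within M (nbhs q), Q y.
    by apply: cvg_within; exact: open_nbhs_nbhs.
  have oM' : \forall y \near within M (nbhs q), M y by exact: withinT.
  near=> y.
  have Vy : V (psi y) by near: y.
  have MWy : (M `&` W) y by split; near: y.
  have Oy : Q y by near: y.
  have Uy : U (psi y) by exact: psiU.
  have phiy : phi (psi y) = y by apply: psiK; rewrite inE.
  split; first by rewrite /= -phi1E// phiy fg// inE; split => //; case: MWy.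
  have Oy' : Q (phi (psi y)) by rewrite phiy.
  have [hy _] := chf y MWy.1.
  rewrite /k /E (deriveE _ (dphi _ Vy)) key// DE -?phi1E//.
  have := Dn0 _ Uy Vy Oy'; rewrite DE -?phi1E// => D0.
  by rewrite mulfK ?gt_eqF// phiy sqrtr_sqr gtr0_norm.
- apply: differentiable_comp; first exact: dphi.
  by apply: dg; rewrite -phi1E// phiu0.
- have dgu : differentiable g (phi1 u0) by apply: dg; rewrite -phi1E// phiu0.
  move=> v; rewrite diff_comp//=; last exact: dphi.
  rewrite -phi1E//; apply: key0 => //.
  by rewrite phiu0.
have dE : differentiable E u0.
  exact: (class_C2_derive_differentiable _ oV (Cphi1 2%N)).
have dD : differentiable D u0.
  have -> : D = \sum_i (fun u => E u 0 i *: 'D_(delta_mx 0 i) g (phi1 u)).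
    by apply/funext => u; rewrite fct_sumE.
  apply: differentiable_sum => i; apply: differentiable_mx => a b.
  have -> : (fun u => (E u 0 i *: 'D_(delta_mx 0 i) g (phi1 u)) a b) =
      (fun u => E u 0 i) * (fun u => 'D_(delta_mx 0 i) g (phi1 u) a b).
    by apply/funext => u; rewrite mxE.
  apply: differentiableM.
    apply: (@differentiable_comp _ _ _ _ E (fun N : 'rV[R]_3 => N 0 i : R)) => //.
    exact: differentiable_coord.
  apply: (@differentiable_comp _ _ _ _ (fun u => 'D_(delta_mx 0 i) g (phi1 u))
    (fun N : 'rV[R]_3 => N a b : R)); last exact: differentiable_coord.
  apply: (@differentiable_comp _ _ _ _ phi1 (fun y => 'D_(delta_mx 0 i) g y)).
    exact: dphi.
  apply: (class_C2_derive_differentiable _ oO (Cg 2%N)).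
  by rewrite -phi1E// phiu0.
have Ou0 : Q (phi u0) by rewrite phiu0.
have Du0 := Dn0 _ Uu0 Vu0 Ou0.
(* The quotient must be positive, since the square root is not differentiable at 0. *)
have Eu0 : 0 < dot (E u0) (E u0).
  rewrite lt_neqAle dot_ge0 andbT eq_sym dot_eq0 /E deriveE; last exact: dphi.
  apply: contra e0 => /eqP dE0; apply/eqP; apply: key0 Uu0 Vu0 Ou0 _.
  by rewrite dE0 linear0.
apply: (@differentiable_comp _ _ _ _
  (fun u => dot (E u) (E u) / dot (D u) (D u)) Num.sqrt).
  apply: (@differentiableM _ _ (fun u => dot (E u) (E u))
     (fun u => (dot (D u) (D u))^-1)); first exact: differentiable_dot.
  by apply: differentiableV; [exact: differentiable_dot|rewrite gt_eqF].
apply/derivable1_diffP.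
exact: (@ex_derive _ _ _ _ _ _ _ (is_derive1_sqrt (divr_gt0 Eu0 Du0))).
Unshelve. all: by end_near. Qed.

Lemma conformal_factor_derive (R : realType) (M : set 'rV[R]_3)
    (f : 'rV[R]_3 -> 'rV[R]_3) (hM : 'rV[R]_3 -> R) (q : 'rV[R]_3) :
  smooth_surface M -> compact M -> smooth_on M f -> set_bij M sphere f ->
  conformal_factor M f hM -> M q ->
  exists a : 'rV[R]_3, forall c X, curve_at sphere (f q) c X ->
    is_derive (0 : R) 1 ((hM \o pinv M f) \o c) (dot a X).
Proof.
move=> sM cM sf [fM finj fsurj] chf Mq.
have [psi [F [k [cpsi eFk dF dFinj dk]]]] := conformal_factor_chart sM sf chf Mq.
set u0 := psi q in dF dFinj dk.
(* Vectors are rows, so injectivity of the differential means that J is row free, and [pinvmx J]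
   then undoes it by multiplication on the right. *)
pose J := lin1_mx ('d F u0).
have Jfree : row_free J by apply: inj_row_free => v; rewrite mul_rV_lin1; exact: dFinj.
pose P := pinvmx J.
(* Coordinates of the linear form X |-> dk(X P). Since P is defined on all of R^3, this vector need
   not be tangent. *)
exists (\row_i 'd k u0 (delta_mx 0 i *m P)) => c X [sc c0 dc].
have aE : dot (\row_i 'd k u0 (delta_mx 0 i *m P)) X = 'd k u0 (X *m P).
  rewrite {2}[X]row_sum_delta mulmx_suml linear_sum; apply: eq_bigr => i _.
  by rewrite mxE -scalemxAl linearZ mulrC.
rewrite aE.
have pM : set_fun sphere M (pinv M f).
  by move=> y sy; apply: (surjpinv_image_sub fsurj); exists y.
have pK : {in sphere, cancel (pinv M f) f} by exact: surjpK.
have pq : pinv M f (f q) = q by apply: pinvKV => //; rewrite inE.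
have cf := smooth_on_within_continuous sf.
have cp := compact_continuous_inverse (@norm_hausdorff _ _) cM cf finj pM pK.
pose m t := pinv M f (c t).
have cc : {for 0, continuous c}.
  by apply/differentiable_continuous/derivable1_diffP; exact: ex_derive.
have m0 : m 0 = q by rewrite /m c0.
(* The inverse of [f] is continuous only within the sphere, so the lifted curve is controlled for
   small t, where [c t] is on the sphere and [m t] in M. *)
have cm : m t @[t --> (0 : R)] --> within M (nbhs q).
  move=> A; rewrite /within /= => MA.
  have cpq := (@subspace_continuousP _ sphere _ (pinv M f)).1 cp (f q) (fM _ Mq).
  rewrite pq in cpq.
  have /cpq : nbhs q (fun y => M y -> A y) by [].
  rewrite /fmap /within /= /nbhs /= -c0 => /cc H.
  have H' : \forall t \near (0 : R), sphere (c t) -> M (m t) -> A (m t) by exact: H.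
  suff : \forall t \near (0 : R), A (m t) by [].
  near=> t.
  have st : sphere (c t) by near: t.
  apply: (near H' t) => //; exact: pM.
have cu : {for 0, continuous (psi \o m)}.
  rewrite /prop_for /continuous_at /= m0; apply: cvg_trans cpsi.
  exact: cvg_app cm.
have um0 : (psi \o m) 0 = u0 by rewrite /= m0.
have eFkm : \forall t \near (0 : R), F (psi (m t)) = f (m t) /\ k (psi (m t)) = hM (m t).
  exact: cm eFk.
(* Apply the criterion to G = P o F, whose differential at [u0] is the identity; along the lifted
   curve G agrees near 0 with P o c, which is differentiable because [c] is. *)
have du : is_derive (0 : R) 1 (psi \o m) (X *m P).
  have dP (y : 'rV[R]_3) : is_diff y (mulmxr P) (mulmxr P).
    by apply: DiffDef; [exact/linear_differentiable/continuous_mulmxr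
                       |exact/diff_lin/continuous_mulmxr].
  have dPF : differentiable (mulmxr P \o F) u0 by exact: differentiable_comp.
  apply: (@is_derive_of_comp _ _ (mulmxr P \o F)) => //; rewrite ?um0//.
    move=> v; rewrite diff_comp// /= diff_val /= -[X in X *m _]/('d F u0 v).
    by rewrite -mul_rV_lin1 mulmxKp.
  have dPc : is_derive (0 : R) 1 (mulmxr P \o c) (X *m P).
    have := @is_derive_diff_comp _ _ _ (mulmxr P) c 0 X (@ex_diff _ _ _ _ _ _ _ (dP _)) dc.
    by rewrite diff_val.
  apply: near_eq_is_derive dPc; near=> t => /=.
  have [-> _] : F (psi (m t)) = f (m t) /\ k (psi (m t)) = hM (m t) by near: t.
  by rewrite pK// inE; near: t.
rewrite -um0 in dk *.
have := is_derive_diff_comp dk du; apply: near_eq_is_derive.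
by near=> t => /=; apply: (near eFkm t _).2.
Unshelve. all: by end_near. Qed.

(** * Green's function, the Hamiltonian and its symplectic gradient *)

Section vortices.
Context {R : realType}.
Implicit Types x y p : 'rV[R]_3.

Lemma greenC x y : green x y = green y x.
Proof. by rewrite /green dotC. Qed.

Lemma greenE x y : sphere x -> sphere y ->
  green x y = - (4 * pi)^-1 * ln ((1 - dot x y) / 2).
Proof.
move=> sx sy; have d1 := sphere_dot_le1 sx sy.
set d := dot x y in d1 *; set s := sin (acos d / 2).
have s0 : 0 <= s.
  apply: sin_ge0_pi; rewrite divr_ge0 ?acos_ge0//=.
  rewrite ler_pdivrMr//; apply: (le_trans (acos_lepi d1)).
  by rewrite ler_peMr ?pi_ge0// ler1n.
have -> : (1 - d) / 2 = s ^+ 2.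
  have : cos (acos d / 2 *+ 2) = d.
    by rewrite -mulr_natr mulfVK// acosK// in_itv.
  by rewrite cos_mulr2n cos2sin2 -/s => <-; field.
rewrite /green -/d -/s.
have -> : ln (s ^+ 2) = 2 * ln s.
  (* The value s = 0 is the diagonal x = y, where both sides vanish by the convention [ln 0 = 0]. *)
  move: s0; rewrite le_eqVlt => /orP[/eqP <-|s0].
    by rewrite expr0n /= ln0// mulr0.
  by rewrite lnXn// mulr_natl.
have : pi != 0 :> R by rewrite gt_eqF ?pi_gt0.
by move: (pi) => b b0; field.
Qed.

Lemma green_derive p y (c : R -> 'rV[R]_3) X :
  sphere p -> sphere y -> p != y -> curve_at sphere p c X ->
  is_derive (0 : R) 1 (fun t => green (c t) y)
    ((4 * pi)^-1 * (1 - dot p y)^-1 * dot y X).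
Proof.
move=> sp sy py [sc c0 dc].
have py1 := sphere_dot_lt1 sp sy py.
have dl : is_derive (0 : R) 1 (fun t => (1 - dot y (c t)) / 2) (- dot y X / 2).
  have -> : (fun t => (1 - dot y (c t)) / 2) =
      2^-1 *: (cst 1 - (fun t => dot y (c t))).
    by apply/funext => t; rewrite [RHS]mulrC.
  have := is_deriveZ 2^-1 (is_deriveB (is_derive_cst (1 : R) (0 : R) (1 : R)) (is_derive_dotl y dc)).
  by move/is_derive_eq; apply; rewrite sub0r [LHS]mulrC.
have l0 : 0 < (1 - dot y (c 0)) / 2 by rewrite c0 dotC divr_gt0// subr_gt0.
have dln := @is_derive1_comp _ (@ln R) (fun t => (1 - dot y (c t)) / 2) 0 _ _
  (is_derive1_ln l0) dl.
have := is_deriveZ (- (4 * pi)^-1) dln.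
move=> D; apply: (@is_derive_eq _ _ _ _ _ _ _
   (- (4 * pi)^-1 *: (((1 - dot y (c 0)) / 2)^-1 * (- dot y X / 2)))).
  apply: near_eq_is_derive D; near=> t => /=.
  rewrite greenE//; first by rewrite dotC.
  by near: t.
have : pi != 0 :> R by rewrite gt_eqF ?pi_gt0.
have : 1 - dot p y != 0 by rewrite gt_eqF// subr_gt0.
rewrite c0 (dotC y p) /GRing.scale /=.
by move: (pi) (dot p y) (dot y X) => b d x d0 b0; field; rewrite d0.
Unshelve. all: by end_near. Qed.

(** Both the interaction terms and the log h term carry the factor -w_j / (4 pi). It is pulled out
    here because the velocity divides by w_j. *)
Lemma hamiltonian_conf_derive n (h : 'rV[R]_3 -> R) (w : 'I_n -> R)
    (p : 'I_n -> 'rV[R]_3) (j : 'I_n) (a : 'rV[R]_3) (c : R -> 'rV[R]_3) X :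
  (forall i, sphere (p i)) -> injective p -> 0 < h (p j) ->
  curve_at sphere (p j) c X -> is_derive (0 : R) 1 (h \o c) (dot a X) ->
  is_derive (0 : R) 1 (fun t => hamiltonian_conf h w (update p j (c t)))
    (dot (- (w j / (4 * pi)) *:
          (\sum_(i < n | i != j) (w i * (1 - dot (p j) (p i))^-1) *: p i
           + ((h (p j))^-1 * w j) *: a)) X).
Proof.
move=> sp ip hj cX dh; have [sc c0 dc] := cX.
pose G i := (4 * pi)^-1 * (1 - dot (p j) (p i))^-1 * dot (p i) X.
have dG i : i != j -> is_derive (0 : R) 1 (fun t => green (c t) (p i)) (G i).
  by move=> ij; apply: green_derive => //; apply: contra ij => /eqP/ip ->.
(* Only pairs containing [j] vary with t; the Kronecker symbols record which of the two entries is
   [j]. *)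
pose D (i k : 'I_n) := if (i < k)%N then
  w i * w k * ((i == j)%:R * G k + (k == j)%:R * G i) else 0.
have dD (i k : 'I_n) : is_derive (0 : R) 1 (fun t => if (i < k)%N then
    w i * w k * green (update p j (c t) i) (update p j (c t) k) else 0) (D i k).
  rewrite /D; case: ifPn => ik; last exact: is_derive_cst.
  apply: is_deriveZ; rewrite /update.
  have [ij|ij] := eqVneq i j; have [kj|kj] := eqVneq k j.
  - by move: ik; rewrite ij kj ltnn.
  - by rewrite mul1r mul0r addr0; exact: dG.
  - rewrite mul0r mul1r add0r.
    by under [X in is_derive _ _ X]eq_fun do rewrite greenC; exact: dG.
  - by rewrite !mul0r addr0; exact: is_derive_cst.
have dH : is_derive (0 : R) 1 (fun t => hamiltonian w (update p j (c t)))
    (- \sum_i \sum_k D i k).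
  have -> : (fun t => hamiltonian w (update p j (c t))) =
    - \sum_(i < n) \sum_(k < n) (fun t : R => if (i < k)%N then
      w i * w k * green (update p j (c t) i) (update p j (c t) k) else 0).
    apply/funext => t; rewrite /hamiltonian [RHS]/GRing.opp /= fct_sumE.
    congr (- _); apply: eq_bigr => i _; rewrite fct_sumE.
    by rewrite big_mkcond.
  by apply: is_deriveN; apply: is_derive_sum => i; apply: is_derive_sum.
pose L (i : 'I_n) : R := (i == j)%:R * (w i ^+ 2 * ((h (p j))^-1 * dot a X)).
have dL i : is_derive (0 : R) 1
    (fun t => w i ^+ 2 * ln (h (update p j (c t) i))) (L i).
  rewrite /L /update; have [->|ij] := eqVneq i j; last first.
    by rewrite mul0r; exact: is_derive_cst.
  rewrite mul1r; apply: is_deriveZ.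
  rewrite -c0 in hj *.
  exact: (@is_derive1_comp _ (@ln R) (h \o c) 0 _ _ (is_derive1_ln hj) dh).
have dS : is_derive (0 : R) 1
    (fun t => (4 * pi)^-1 * \sum_(i < n) w i ^+ 2 * ln (h (update p j (c t) i)))
    ((4 * pi)^-1 * \sum_i L i).
  apply: is_deriveZ.
  have -> : (fun t => \sum_(i < n) w i ^+ 2 * ln (h (update p j (c t) i))) =
      \sum_(i < n) (fun t => w i ^+ 2 * ln (h (update p j (c t) i))).
    by apply/funext => t; rewrite fct_sumE.
  exact: is_derive_sum.
apply: (is_derive_eq (is_deriveB dH dS)).
have SL : \sum_i L i = w j ^+ 2 * ((h (p j))^-1 * dot a X).
  rewrite (bigD1 j)//= big1 => [|i ij]; first by rewrite /L eqxx mul1r addr0.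
  by rewrite /L (negPf ij) mul0r.
(* The ordered pairs containing [j] have [j] either first or second; together they run once over all
   indices different from [j]. *)
have SD : \sum_i \sum_k D i k = w j * \sum_(i < n | i != j) w i * G i.
  have -> : \sum_i \sum_k D i k =
     \sum_(k < n | (j < k)%N) w j * (w k * G k)
     + \sum_(i < n | (i < j)%N) w j * (w i * G i).
    transitivity (\sum_(i < n) \sum_(k < n) ((i == j)%:R * (if (j < k)%N then w j * (w k * G k) else 0)
       + (k == j)%:R * (if (i < j)%N then w j * (w i * G i) else 0))).
      apply: eq_bigr => i _; apply: eq_bigr => k _; rewrite /D.
      have [->|ij] := eqVneq i j; have [->|kj] := eqVneq k j;
        rewrite ?ltnn ?(mul1r, mul0r, mulr0, addr0, add0r)//; case: ifP => // _; ring.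
    under eq_bigr do rewrite big_split /=.
    rewrite big_split /=; congr (_ + _).
      rewrite (bigD1 j)//= [X in _ + X]big1 ?addr0 => [|i ij].
        rewrite [RHS]big_mkcond; apply: eq_bigr => k _.
        by rewrite eqxx mul1r.
      by rewrite big1// => k _; rewrite (negPf ij) mul0r.
    rewrite [RHS]big_mkcond; apply: eq_bigr => i _.
    rewrite (bigD1 j)//= [X in _ + X]big1 ?addr0 => [|k kj]; first by rewrite eqxx mul1r.
    by rewrite (negPf kj) mul0r.
  rewrite mulr_sumr [RHS](bigID (fun k : 'I_n => (j < k)%N)) /=.
  congr (_ + _); apply: eq_bigl => i.
    by rewrite andbC; have [->|_] := eqVneq i j; rewrite ?ltnn ?andbT.
  by rewrite -leqNgt ltn_neqAle.
rewrite SD SL dotZl dotDl dotZl dot_suml.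
have -> : \sum_(i < n | i != j) dot ((w i * (1 - dot (p j) (p i))^-1) *: p i) X =
   4 * pi * \sum_(i < n | i != j) w i * G i.
  rewrite mulr_sumr; apply: eq_bigr => i ij; rewrite dotZl /G.
  rewrite -(mulrA (4 * pi)^-1) (mulrCA (w i)) mulVKf ?mulrA//.
  by rewrite mulf_neq0 ?gt_eqF ?pi_gt0.
have : pi != 0 :> R by rewrite gt_eqF ?pi_gt0.
have : h (p j) != 0 by rewrite gt_eqF.
set S := \sum_(i < n | i != j) w i * G i.
by move: (pi) S (h (p j)) => b S d d0 b0; field; rewrite d0.
Qed.

Lemma sgrad_hamE n (h : 'rV[R]_3 -> R) (w : 'I_n -> R)
    (p : 'I_n -> 'rV[R]_3) (j : 'I_n) (a : 'rV[R]_3) :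
  (forall i, sphere (p i)) -> injective p -> 0 < h (p j) ->
  (forall c X, curve_at sphere (p j) c X ->
     is_derive (0 : R) 1 (h \o c) (dot a X)) ->
  sgrad_ham h w p j = - w j *: ((4 * pi * h (p j) ^+ 2)^-1 *:
        (\sum_(i < n | i != j)
            w i *: ((1 - dot (p j) (p i))^-1 *: cross (p j) (p i))
         + ((h (p j))^-1 * w j) *: cross (p j) a)).
Proof.
move=> sp ip hj dh.
rewrite /sgrad_ham /sgrad_star.
rewrite (sgradE (sp j) (fun c X cX => hamiltonian_conf_derive w sp ip hj cX (dh c X cX))).
rewrite crossZr crossDr crossZr cross_sumr.
have -> : \sum_(i < n | i != j)
    cross (p j) ((w i * (1 - dot (p j) (p i))^-1) *: p i) =
  \sum_(i < n | i != j) w i *: ((1 - dot (p j) (p i))^-1 *: cross (p j) (p i)).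
  by apply: eq_bigr => i _; rewrite crossZr scalerA.
rewrite !scalerA; congr (_ *: _).
by rewrite [in RHS]invfM mulrC !mulNr mulrA.
Qed.

(** The quotient is unique even at 0: if s Q(s) = s Q'(s) for all s, then X Q = X Q' as polynomials
    because R is infinite, and X cancels. *)
Lemma cancel_factorE (F : R -> 'rV[R]_3) (t : R) (Q : 'I_3 -> {poly R}) :
  (forall s, F s = s *: \row_i (Q i).[s]) ->
  cancel_factor F t = \row_i (Q i).[t].
Proof.
move=> FQ; rewrite /cancel_factor.
have [Q' [FQ' ->]] := getPex (ex_intro
  (fun u => [set u | exists Q : 'I_3 -> {poly R},
    (forall s, F s = s *: \row_i (Q i).[s]) /\ u = \row_i (Q i).[t]] u)
  _ (ex_intro _ Q (conj FQ erefl))).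
apply/rowP => i; rewrite !mxE; congr (_.[_]).
apply: (@mulfI _ 'X); first by rewrite polyX_eq0.
apply/eqP; rewrite -subr_eq0; apply/eqP.
set P := (_ - _); have P0 s : P.[s] = 0.
  have := FQ s; rewrite FQ' => /rowP/(_ i); rewrite !mxE => H.
  by rewrite /P !hornerE H subrr.
apply: contrapT => /eqP nP.
(* The numbers 0, ..., size P - 1 are distinct in characteristic zero and would be one root too many
   for a nonzero P. *)
have := @max_poly_roots _ P [seq (k%:R : R) | k <- iota 0 (size P)] nP.
rewrite size_map size_iota ltnn => H; suff: false by []; apply: H.
  by apply/allP => s _; apply/rootP.
by rewrite map_inj_uniq ?iota_uniq//; exact: mulrIn (oner_neq0 _).
Qed.

End vortices.

Theorem theorem50 (R : realType) (M : set 'rV[R]_3)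
    (f : 'rV[R]_3 -> 'rV[R]_3) (hM : 'rV[R]_3 -> R)
    (n : nat) (q : 'I_n -> 'rV[R]_3) (w : 'I_n -> R) :
  closed_surface M -> genus_zero M ->
  conformal_map M f -> conformal_factor M f hM ->
  (forall i, M (q i)) -> injective q ->
  \sum_(i < n) w i = 0 ->
  let h : 'rV[R]_3 -> R := hM \o pinv M f in
  let p : 'I_n -> 'rV[R]_3 := fun i => f (q i) in
  forall j : 'I_n,
    velocity h w p j =
      (4 * pi * h (p j) ^+ 2)^-1 *:
        (\sum_(i < n | i != j)
            w i *: ((1 - dot (p j) (p i))^-1 *: cross (p j) (p i))
         + ((h (p j))^-1 * w j) *: cross (p j) (sphere_grad h (p j))).
Proof.
move=> [sM cM _] _ [sf bf _] chf Mq iq _ h p j.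
have [fM finj _] := bf.
have sp i : sphere (p i) by exact: fM.
have ip : injective p by move=> i k /finj pik; apply: iq; apply: pik; rewrite inE.
have hj : 0 < h (p j).
  rewrite /h /p /= pinvKV ?inE//; first exact: (chf _ (Mq j)).1.
have [a da] := conformal_factor_derive sM cM sf bf chf (Mq j).
(* The gradient of h in the goal may be replaced by the ambient vector [a], as they differ by a
   multiple of [p j]. *)
rewrite -/(sgrad h (p j)) (sgradE (sp j) da).
have HE w' := sgrad_hamE w' sp ip hj da.
rewrite /velocity; case: ifPn => [wj|/negPn/eqP wj].
  by rewrite HE scalerA mulrNN mulVf// scale1r.
set C := (4 * pi * _)^-1.
pose S := \sum_(i < n | i != j)
  w i *: ((1 - dot (p j) (p i))^-1 *: cross (p j) (p i)).
pose B := (h (p j))^-1 *: cross (p j) a.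
(* The symplectic gradient divided by s, an affine function of s. At s = 0 the part coming from log
   h drops out, as does the last term of the goal when w_j = 0. *)
pose Q (i : 'I_3) : {poly R} := - (C * S 0 i)%:P - (C * B 0 i) *: 'X.
have QE i s : (Q i).[s] = - (C * S 0 i) - C * B 0 i * s by rewrite /Q !hornerE.
rewrite (@cancel_factorE _ _ _ Q) => [|s].
  rewrite wj mulr0 scale0r addr0 -/S; apply/rowP => i.
  by rewrite !mxE QE mulr0 subr0 opprK.
rewrite HE -/C {1}/update eqxx.
have -> : \sum_(i < n | i != j)
    update w j s i *: ((1 - dot (p j) (p i))^-1 *: cross (p j) (p i)) = S.
  by apply: eq_bigr => i ij; rewrite /update (negPf ij).
rewrite {1}/update eqxx mulrC -scalerA -/B; apply/rowP => i.
have E (S' B' : 'rV[R]_3) : (- s *: (C *: (S' + s *: B'))) 0 i =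
    s * (- (C * S' 0 i) - C * B' 0 i * s) by rewrite !mxE; ring.
by rewrite E [RHS]mxE [in RHS]mxE QE.
Qed.
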